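(* Let $k<\omega$. Let $\mathcal{G}^{>k}$ be the class of graphs $(X,R)$ (i.e. $X\neq\varnothing$ and $R\subseteq X\times X$ symmetric) with $\chi(X,R)>k$, and $\mathcal{D}^{>k}$ the class of directed graphs $(X,R)$ (i.e. $X\neq\varnothing$, $R\subseteq X\times X$ arbitrary) with $\chi(X,R)>k$. For a class $\mathcal{F}$ of such structures let $\mathcal{F}^{\neq}=\{(X,R,\neq_X):(X,R)\in\mathcal{F}\}$, where $\neq_X=\{(x,y)\in X\times X: x\neq y\}$. Then the bimodal logic of the class $(\mathcal{G}^{>k})^{\neq}$ equals $\mathrm{KB}^{\neq}+\chi_k$, and the bimodal logic of the class $(\mathcal{D}^{>k})^{\neq}$ equals $\mathrm{K}^{\neq}+\chi_k$.
   Context: Bimodal formulas are built from countably many variables with $\bot,\to$ and modalities $\lozenge$ (interpreted by the first relation) and $\langle\neq\rangle$ (interpreted by the second relation) in Kripke frames $(X,R,D)$ in the standard way; $\exists\varphi:=\langle\neq\rangle\varphi\vee\varphi$, $\forall\varphi:=[\neq]\varphi\wedge\varphi$. The logic of a class of frames is the set of formulas valid in all frames of the class. Normal logics and $L+\Phi$ are as usual; $\mathrm{K}$ is the smallest normal unimodal logic, $\mathrm{KB}=\mathrm{K}+(p\to\Box\lozenge p)$; for a unimodal logic $L$, $L^{\neq}$ is the smallest normal bimodal logic containing $L$ and $p\to[\neq]\langle\neq\rangle p$, $\langle\neq\rangle\langle\neq\rangle p\to\exists p$, $\lozenge p\to\exists p$. $\chi_k$ is the formula $\forall \bigvee_{i<k}(p_i\wedge\bigwedge_{i\neq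 j<k}\neg p_j)\to \exists\bigvee_{i<k}(p_i\wedge\lozenge p_i)$. For $R\subseteq X\times X$, a partition $\mathcal{A}$ of $X$ is proper if no $A\in\mathcal{A}$ contains $x,y$ with $xRy$; $\chi(X,R)$ is the least cardinality of a finite proper partition of $X$, and $\infty$ if there is none. *)

(* Defs.v *)
From mathcomp Require Import all_boot.
From mathcomp Require Import boolp classical_sets functions cardinality.

Set Implicit Arguments.
Unset Strict Implicit.
Unset Printing Implicit Defensive.

Local Open Scope classical_set_scope.
Local Open Scope card_scope.

(** * Formulas *)

(* Formulas with one diamond for each index in [I]; the propositional
   variables are indexed by [nat]. *)
Inductive form (I : Type) : Type :=
| Var of nat
| Bot
| Imp of form I & form I
| Dia of I & form I.

Arguments Var {I} _.
Arguments Bot {I}.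

Section Connectives.
Variable I : Type.
Implicit Types (i : I) (a b : form I).

Definition Neg a := Imp a Bot.
Definition Top : form I := Neg Bot.
Definition Or a b := Imp (Neg a) b.
Definition And a b := Neg (Imp a (Neg b)).
Definition Box i a := Neg (Dia i (Neg a)).

Fixpoint subst (s : nat -> form I) a : form I :=
  match a with
  | Var n => s n
  | Bot => Bot
  | Imp b c => Imp (subst s b) (subst s c)
  | Dia i b => Dia i (subst s b)
  end.

(* [v] evaluates variables and formulas of the form [Dia i b] arbitrarily, so
   that [taut] consists of the substitution instances of the classical
   tautologies. *)
Fixpoint boolean_eval (v : form I -> bool) a : bool :=
  match a with
  | Bot => false
  | Imp b c => boolean_eval v b ==> boolean_eval v c
  | _ => v a
  end.

Definition taut a : Prop := forall v, boolean_eval v a.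

End Connectives.

Arguments Top {I}.

(** * Normal logics *)

(* The axioms are given for the primitive diamonds; closure under
   monotonicity, rather than necessitation, avoids a separate axiom relating
   [Dia i] with [Box i]. *)
Definition normal (I : Type) (L : set (form I)) : Prop :=
  [/\ @taut I `<=` L,
      (forall i, L (Imp (Dia i Bot) Bot)) /\
      (forall i, L (Imp (Dia i (Or (Var 0) (Var 1)))
                        (Or (Dia i (Var 0)) (Dia i (Var 1))))),
      (forall a b, L (Imp a b) -> L a -> L b),
      (forall s a, L a -> L (subst s a)) &
      (forall i a b, L (Imp a b) -> L (Imp (Dia i a) (Dia i b)))].

(* [L + Phi] *)
Definition extend (I : Type) (L Phi : set (form I)) : set (form I) :=
  smallest (@normal I) (L `|` Phi).

(* Unimodal formulas have their modality indexed by [unit]. *)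
Definition logicK : set (form unit) := smallest (@normal unit) set0.

Definition logicKB : set (form unit) :=
  extend logicK [set Imp (Var 0) (Box tt (Dia tt (Var 0)))].

(** * Bimodal formulas *)

Inductive modality := First | Second.

Notation bform := (form modality).

Fixpoint bimodal (a : form unit) : bform :=
  match a with
  | Var n => Var n
  | Bot => Bot
  | Imp b c => Imp (bimodal b) (bimodal c)
  | Dia _ b => Dia First (bimodal b)
  end.

Definition Exists (a : bform) : bform := Or (Dia Second a) a.
Definition Forall (a : bform) : bform := And (Box Second a) a.

Definition neq_axioms : set bform :=
  [set a | [\/ a = Imp (Var 0) (Box Second (Dia Second (Var 0))),
               a = Imp (Dia Second (Dia Second (Var 0))) (Exists (Var 0)) |
               a = Imp (Dia First (Var 0)) (Exists (Var 0))]].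

(* [L^{≠}] *)
Definition neq_logic (L : set (form unit)) : set bform :=
  smallest (@normal modality) (bimodal @` L `|` neq_axioms).

Definition chi_form (k : nat) : bform :=
  Imp (Forall (\big[@Or modality/Bot]_(i < k)
                 And (Var i)
                     (\big[@And modality/Top]_(j < k | j != i) Neg (Var j))))
      (Exists (\big[@Or modality/Bot]_(i < k)
                 And (Var i) (Dia First (Var i)))).

(** * Kripke frames *)

Record frame := Frame {
  world : Type;
  rel1 : world -> world -> Prop;
  rel2 : world -> world -> Prop
}.

Definition frame_rel (F : frame) (m : modality) :=
  match m with First => @rel1 F | Second => @rel2 F end.

Fixpoint sat (F : frame) (V : nat -> world F -> Prop) (x : world F)
    (a : bform) : Prop :=
  match a with
  | Var n => V n x
  | Bot => False
  | Imp b c => sat V x b -> sat V x c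
  | Dia m b => exists y, frame_rel m x y /\ sat V y b
  end.

Definition valid (F : frame) (a : bform) : Prop :=
  forall (V : nat -> world F -> Prop) (x : world F), sat V x a.

(* Classes of structures are predicates rather than [set]s: [set] is not
   universe polymorphic, and applying it to the type of all frames would
   prevent frames from having worlds in types such as [set bform]. *)
Definition logic_of (C : frame -> Prop) : set bform :=
  [set a | forall F, C F -> valid F a].

(** * Graphs and chromatic numbers *)

Record digraph := Digraph {
  vertex : Type;
  edge : vertex -> vertex -> Prop;
  vertex_inhabited : inhabited vertex
}.

Definition symmetric_edge (G : digraph) : Prop :=
  forall x y : vertex G, edge x y -> edge y x.

(* [x] and [y] may coincide, so a vertex with a loop lies in no block of a
   proper partition. *)
Definition proper_partition (G : digraph) (A : set (set (vertex G))) : Prop :=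
  partition A id [set: vertex G] /\
  forall B, A B -> ~ exists x y, [/\ B x, B y & edge x y].

Definition partition_size (G : digraph) (n : nat) : Prop :=
  exists A, @proper_partition G A /\ A #= `I_n.

Definition ex_partition_size (G : digraph) : Prop :=
  exists n, `[< partition_size G n >].

(* [None] stands for infinity. *)
Definition chromatic_number (G : digraph) : option nat :=
  match pselect (ex_partition_size G) with
  | left ex => Some (ex_minn ex)
  | right _ => None
  end.

Definition chromatic_gt (G : digraph) (k : nat) : Prop :=
  match chromatic_number G with
  | Some n => (k < n)%N
  | None => True
  end.

Definition digraphs_gt (k : nat) (G : digraph) : Prop := chromatic_gt G k.

Definition graphs_gt (k : nat) (G : digraph) : Prop :=
  symmetric_edge G /\ chromatic_gt G k.

Definition neq_frame (G : digraph) : frame :=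
  @Frame (vertex G) (@edge G) (fun x y => x <> y).

Definition neq_class (C : digraph -> Prop) : frame -> Prop :=
  fun F => exists2 G, C G & F = neq_frame G.

(* Main.v *)
(* Soundness: a valuation of p_0, ..., p_(k-1) satisfying the premise of chi_k
   is a colouring with k colours, which some edge must violate.

   Completeness: refute a formula a at a point x0 of the canonical model, and
   restrict the model to the points reachable from x0, where distinct points
   are related by the second relation. Quotient by agreement on the subformulas
   of a, taking the least relations; the first one stays symmetric. Unions of
   classes are definable, so a proper colouring of the quotient with k colours
   would be a substitution refuting the instance of chi_k at x0. Finally, double
   the classes related to themselves by the second relation; this makes it
   inequality, and proper colourings restrict to one copy of each class. *)

Require Import Defs.
From mathcomp Require Import all_boot.
From mathcomp Require Import boolp classical_sets functions cardinality.

Set Implicit Arguments.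
Unset Strict Implicit.
Unset Printing Implicit Defensive.

Local Open Scope classical_set_scope.
Local Open Scope card_scope.

(** * Satisfaction *)

Lemma sat_OrE F V (x : world F) a b :
  sat V x (Or a b) <-> sat V x a \/ sat V x b.
Proof.
split=> /= [ab|[xa /(_ xa)|xb _]] //.
by have [xa|xa] := pselect (sat V x a); [left | right; apply: ab].
Qed.

Lemma sat_AndE F V (x : world F) a b :
  sat V x (And a b) <-> sat V x a /\ sat V x b.
Proof.
split=> [/= ab|[xa xb] /= /(_ xa)]; last exact.
by split; apply: contrapT => nx; apply: ab => xa.
Qed.

Lemma sat_BoxE F V (x : world F) m a :
  sat V x (Box m a) <-> forall y, frame_rel m x y -> sat V y a.
Proof.
split=> [/= nxa y xy|xa /= [y [/xa]]]; last by [].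
by apply: contrapT => ya; apply: nxa; exists y.
Qed.

Lemma sat_ExistsE F V (x : world F) a :
  sat V x (Exists a) <-> exists2 y, rel2 x y \/ x = y & sat V y a.
Proof.
rewrite sat_OrE /=; split=> [[[y [xy ya]]|xa]|[y [xy|<-] ya]].
- by exists y => //; left.
- by exists x => //; right.
- by left; exists y.
- by right.
Qed.

Lemma sat_ForallE F V (x : world F) a :
  sat V x (Forall a) <-> forall y, rel2 x y \/ x = y -> sat V y a.
Proof.
rewrite sat_AndE sat_BoxE; split=> [[xa ax] y [/xa|<-]|xa] //.
by split=> [y xy|]; apply: xa; [left|right].
Qed.

Lemma sat_big_OrE F V (x : world F) (J : finType) (P : pred J) f :
  sat V x (\big[@Or modality/Bot]_(j | P j) f j) <->
  exists2 j, P j & sat V x (f j).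
Proof.
(* Membership in the enumeration is made explicit so that induction on the list applies. *)
transitivity (exists2 j, (j \in index_enum J) && P j & sat V x (f j)); last first.
  by split=> -[j Pj xj]; exists j; move: Pj; rewrite ?mem_index_enum.
elim: (index_enum J) => [|i r IHr]; first by rewrite big_nil; split=> // -[].
rewrite big_cons; case: ifPn => Pi; first rewrite sat_OrE.
  rewrite IHr; split=> [[xi|[j /andP[jr Pj] xj]]|[j /andP[]]].
  - by exists i; rewrite ?mem_head.
  - by exists j; rewrite // inE jr orbT.
  - rewrite inE => /orP[/eqP->|jr] Pj xj; first by left.
    by right; exists j; rewrite ?jr.
rewrite IHr; split=> -[j /andP[jr Pj] xj]; exists j; rewrite // ?inE ?jr ?orbT //.
rewrite inE in jr; case/orP: jr => [/eqP ji|->//].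
by rewrite ji (negPf Pi) in Pj.
Qed.

Lemma sat_big_AndE F V (x : world F) (J : finType) (P : pred J) f :
  sat V x (\big[@And modality/Top]_(j | P j) f j) <->
  forall j, P j -> sat V x (f j).
Proof.
transitivity (forall j, (j \in index_enum J) && P j -> sat V x (f j)); last first.
  by split=> xf j Pj; apply: xf; move: Pj; rewrite ?mem_index_enum.
elim: (index_enum J) => [|i r IHr]; first by rewrite big_nil; split=> [|_ []].
rewrite big_cons; case: ifPn => Pi; first rewrite sat_AndE.
  rewrite IHr; split=> [[xi xr] j /andP[]|xf].
    by rewrite inE => /orP[/eqP->//|jr] Pj; apply: xr; rewrite jr.
  split; first by apply: xf; rewrite mem_head.
  by move=> j /andP[jr Pj]; apply: xf; rewrite inE jr orbT.
rewrite IHr; split=> xf j /andP[jr Pj]; apply: xf; rewrite ?inE ?jr ?orbT //.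
rewrite inE in jr; case/orP: jr => [/eqP ji|->//].
by rewrite ji (negPf Pi) in Pj.
Qed.

Lemma sat_chi_formE F V (x : world F) k :
  sat V x (chi_form k) <->
  ((forall y, rel2 x y \/ x = y ->
      exists2 i : 'I_k, V i y & forall j : 'I_k, j != i -> ~ V j y) ->
   exists2 y, rel2 x y \/ x = y &
     exists i : 'I_k, V i y /\ exists2 z, rel1 y z & V i z).
Proof.
have onlyE y : sat V y (\big[@Or modality/Bot]_(i < k)
      And (Var i) (\big[@And modality/Top]_(j < k | j != i) Neg (Var j))) <->
    exists2 i : 'I_k, V i y & forall j : 'I_k, j != i -> ~ V j y.
  rewrite sat_big_OrE; split.
    by move=> [i _ /sat_AndE[yi /sat_big_AndE yj]]; exists i.
  by move=> [i yi yj]; exists i => //; apply/sat_AndE; split=> //; apply/sat_big_AndE.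
have monoE y : sat V y (\big[@Or modality/Bot]_(i < k)
      And (Var i) (Dia First (Var i))) <->
    exists i : 'I_k, V i y /\ exists2 z, rel1 y z & V i z.
  rewrite sat_big_OrE; split.
    by move=> [i _ /sat_AndE[yi [z [yz zi]]]]; exists i; split=> //; exists z.
  by move=> [i [yi [z yz zi]]]; exists i => //; apply/sat_AndE; split=> //; exists z.
rewrite /chi_form; split=> [chi yc|chi /sat_ForallE yc].
  have yF := (sat_ForallE _ _ _).2 (fun y xy => (onlyE y).2 (yc y xy)).
  by have [y xy /monoE ym] := (sat_ExistsE _ _ _).1 (chi yF); exists y.
have [y /yc/onlyE //|y xy /monoE ym] := chi.
by apply/sat_ExistsE; exists y.
Qed.

Lemma sat_subst F V (x : world F) s a :
  sat V x (subst s a) <-> sat (fun n y => sat V y (s n)) x a.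
Proof.
elim: a x => [n|//|b IHb c IHc|m b IHb] //= x; first by rewrite IHb IHc.
by split=> -[y [xy /IHb yb]]; exists y.
Qed.

(** Diamond formulas count as atoms for [boolean_eval], so their truth at [x] is an admissible
    assignment; this is why tautologies are valid in every frame. *)
Lemma boolean_eval_sat F V (x : world F) a :
  boolean_eval (fun b => `[< sat V x b >]) a = `[< sat V x a >].
Proof.
elim: a => [n||b IHb c IHc|m b IHb] //=; first by rewrite asboolF.
by rewrite IHb IHc asbool_imply.
Qed.

(** * Normal logics *)

Lemma smallest_normal I (G : set (form I)) : normal (smallest (@normal I) G).
Proof.
split.
- by move=> a ta L [[+ _ _ _ _] _]; apply.
- by split=> i L [[_ [? ?] _ _ _] _].
- move=> a b Lab La L LG; case: (LG) => -[_ _ + _ _] _; apply; first exact: Lab.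
  exact: La.
- by move=> s a La L LG; case: (LG) => -[_ _ _ + _] _; apply; apply: La.
- by move=> i a b Lab L LG; case: (LG) => -[_ _ _ _ +] _; apply; apply: Lab.
Qed.

Lemma normal_logic_of (C : frame -> Prop) : normal (logic_of C).
Proof.
split.
- move=> a ta F _ V x; apply/asboolP; rewrite -boolean_eval_sat; exact: ta.
- split=> m F _ V x /=; first by move=> [y []].
  move=> -[y [xy yor]] nx; exists y; split=> //.
  by apply: yor => y0; apply: nx; exists y.
- by move=> a b Lab La F CF V x; apply: (Lab F CF V x); apply: La.
- by move=> s a La F CF V x; apply/sat_subst; apply: La.
- by move=> m a b Lab F CF V x [y [xy ya]]; exists y; split=> //; apply: Lab.
Qed.

Lemma boolean_eval_bimodal v a :
  boolean_eval v (bimodal a) = boolean_eval (v \o bimodal) a.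
Proof. by elim: a => //= b -> c ->. Qed.

Lemma bimodal_subst s a : bimodal (subst s a) = subst (bimodal \o s) (bimodal a).
Proof. by elim: a => //= [b -> c ->|_ b ->]. Qed.

(** By leastness, all of [logicK] or [logicKB] translates into a normal bimodal logic as soon as its
    axioms do. *)
Lemma normal_bimodal L : normal L -> normal (bimodal @^-1` L).
Proof.
move=> [tL [bL dL] mpL sL mL]; split.
- by move=> a ta; apply: tL => v; rewrite boolean_eval_bimodal.
- by split=> i; [apply: bL | apply: dL].
- by move=> a b; apply: mpL.
- by move=> s a La; rewrite /= bimodal_subst; apply: sL.
- by move=> i a b; apply: mL.
Qed.

Lemma chi_logic_sub L0 L k :
  normal L -> L0 `<=` bimodal @^-1` L -> neq_axioms `<=` L -> L (chi_form k) ->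
  extend (neq_logic L0) [set chi_form k] `<=` L.
Proof.
move=> nL L0L neqL chiL; apply: smallest_sub => // a [|->//]; move: a.
by apply: smallest_sub => // a [[b /L0L Lb <-]|/neqL].
Qed.

Lemma neq_axioms_valid G : neq_axioms `<=` valid (neq_frame G).
Proof.
move=> _ [] -> V x.
- move=> xp; apply/sat_BoxE => y xy; exists x; split=> //; exact: nesym.
- move=> [y [_ [z [_ zp]]]]; apply/sat_ExistsE; exists z => //.
  by have [->|] := pselect (x = z); [right|left].
- move=> [y [_ yp]]; apply/sat_ExistsE; exists y => //.
  by have [->|] := pselect (x = y); [right|left].
Qed.

(** * The canonical model *)

Lemma normal_Imp I (L : set (form I)) a b : normal L -> L b -> L (Imp a b).
Proof.
move=> [tL _ mpL _ _] Lb; apply: (mpL _ _ _ Lb); apply: tL => v /=.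
by case: boolean_eval => //; rewrite implybT.
Qed.

(** Closure under modus ponens alone: a theory describes one world, where truth need not be
    preserved by substitution or monotonicity. *)
Definition theory I (L T : set (form I)) : Prop :=
  L `<=` T /\ forall a b, T (Imp a b) -> T a -> T b.

Lemma theory_deduction I (L T : set (form I)) c : normal L -> theory L T ->
  theory L [set a | T (Imp c a)].
Proof.
move=> nL [LT mpT]; split=> [a La|a b Tcab Tca]; first by apply: LT; apply: normal_Imp.
apply: (mpT _ _ _ Tca); apply: (mpT _ _ _ Tcab); apply: LT; case: nL => + _ _ _ _; apply=> v /=.
by do !case: boolean_eval.
Qed.

Definition complete_theory I (L T : set (form I)) : Prop :=
  theory L T /\ forall a, T (Neg a) <-> ~ T a.

(** Zorn's lemma gives a theory maximal among those that contain [T] and omit [c]. In it every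
    formula outside implies [c], so [a] and [Neg a] cannot both be outside. *)
Lemma lindenbaum I (L T : set (form I)) c : normal L -> theory L T -> ~ T c ->
  exists2 U, complete_theory L U & T `<=` U /\ ~ U c.
Proof.
move=> nL thT Tc.
have tL a : taut a -> L a by case: nL => + _ _ _ _; apply.
pose P (A : set (form I)) := theory L (T `|` A) /\ ~ (T `|` A) c.
have [F FP Ftot|A [[thA Ac] Amax]] := Zorn_bigcup (P := P).
  (* Ordering the sets [A] added to [T], rather than the theories themselves, settles the empty
     chain: its union is empty and [T] itself omits [c]. *)
  have [[X0 FX0]|F0] := pselect (F !=set0); last first.
    rewrite /P (_ : \bigcup_(X in F) X = set0) ?setU0 //.
    by rewrite -subset0 => a [X FX _]; apply: F0; exists X.
  have UF a : (T `|` \bigcup_(X in F) X) a -> exists2 X, F X & (T `|` X) a.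
    by move=> [Ta|[X FX Xa]]; [exists X0 => //; left | exists X => //; right].
  have FU X : F X -> T `|` X `<=` T `|` \bigcup_(X in F) X.
    by move=> FX a [Ta|Xa]; [left | right; exists X].
  split; last by move=> /UF[X /FP[_ +]] Xc; apply.
  split=> [a La|a b /UF[X FX Xab] /UF[Y FY Ya]].
    by have [[LX _] _] := FP _ FX0; apply/(FU _ FX0)/LX.
  have [/FP[[_ mpX] _] /FP[[_ mpY] _]] := (FX, FY).
  have [XY|YX] := Ftot _ _ FX FY.
    by apply/(FU _ FY)/(mpY a) => //; apply: setUS Xab.
  by apply/(FU _ FX)/(mpX a) => //; apply: setUS Ya.
set U := T `|` A in thA Ac.
have [LU mpU] := thA.
have UT : T `<=` U by move=> a; left.
(* Otherwise the consequences of [U] together with [a] form a strictly larger theory that still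
   omits [c]. *)
have maxU a : ~ U a -> U (Imp a c).
  move=> Ua; apply: contrapT => Uac.
  have UA' : U `<=` [set b | U (Imp a b)].
    by move=> b; apply: mpU; apply/LU/tL => v /=; do !case: boolean_eval.
  apply: (Amax [set b | U (Imp a b)]).
    split; first by move=> b Ab; apply/UA'; right.
    by move=> /(_ a) Aa; apply: Ua; right; apply: Aa; apply/LU/tL => v /=; case: boolean_eval.
  rewrite /P (setUidr (subset_trans UT UA')); split=> //.
  exact: theory_deduction.
exists U => //; split=> // a; split=> [Una Ua|Ua].
  apply: Ac; apply: (mpU Bot c); first by apply/LU/tL => v /=.
  exact: mpU Una Ua.
apply: contrapT => /maxU Unac; apply: Ac.
apply: (mpU _ _ _ (maxU _ Ua)); apply: (mpU _ _ _ Unac); apply/LU/tL => v /=.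
by do !case: boolean_eval.
Qed.

Lemma complete_theory_ImpE I (L T : set (form I)) a b : normal L ->
  complete_theory L T -> T (Imp a b) <-> (T a -> T b).
Proof.
move=> nL [[LT mpT] negT]; have tL e : taut e -> T e.
  by move=> te; apply: LT; case: nL => + _ _ _ _; apply.
split=> [|ab]; first exact: mpT.
have [/ab Tb|Ta] := pselect (T a).
  by apply: (mpT _ _ _ Tb); apply: tL => v /=; do !case: boolean_eval.
by apply: (mpT _ _ _ ((negT a).2 Ta)); apply: tL => v /=; do !case: boolean_eval.
Qed.

Lemma complete_theory_Bot I (L T : set (form I)) : normal L ->
  complete_theory L T -> ~ T Bot.
Proof.
move=> nL [[LT mpT] negT]; apply/negT/LT.
by case: nL => + _ _ _ _; apply=> v.
Qed.

(** The formulas [b] with [Box m b] in [T], which completeness of [T] expresses as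
    [~ T (Dia m (Neg b))], form a theory. It omits [Neg a] because [T] contains [Dia m a]; a
    complete extension omitting [Neg a] is the successor sought. *)
Lemma complete_theory_Dia I (L T : set (form I)) m a : normal L ->
  complete_theory L T -> T (Dia m a) ->
  exists U, [/\ complete_theory L U, U a & forall b, U b -> T (Dia m b)].
Proof.
move=> nL cT Ta; have [[LT mpT] negT] := cT.
have [tL [botL orL] mpL sL monoL] := nL.
have TBot := complete_theory_Bot nL cT.
have mono b c : taut (Imp b c) -> T (Dia m b) -> T (Dia m c).
  by move=> /tL/(monoL m)/LT; apply: mpT.
have orT b c : T (Dia m (Or b c)) -> T (Dia m b) \/ T (Dia m c).
  move=> Tbc; have := sL (fun n => if n is 0 then b else c) _ (orL m).
  move=> /LT/mpT/(_ Tbc) /=; rewrite !(complete_theory_ImpE _ _ nL cT) => bc'.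
  have [|Tb] := pselect (T (Dia m b)); first by left.
  by right; apply: bc' => /Tb.
have thB : theory L [set b | ~ T (Dia m (Neg b))].
  split=> [b Lb Tb|b c /= Tbc Tb Tc].
    apply: TBot; apply: (mpT _ _ (LT _ (botL m))).
    apply: mpT Tb; apply/LT/monoL; apply: (mpL b) => //.
    by apply: tL => v /=; case: boolean_eval.
  have [] : T (Dia m (Neg (Imp b c))) \/ T (Dia m (Neg b)) => //.
  by apply/orT/(mono _ _ _ Tc) => v /=; do !case: boolean_eval.
have [|U cU [TU Ua]] := lindenbaum (c := Neg a) nL thB.
  by apply; apply: mono Ta => v /=; case: boolean_eval.
exists U; split=> //; first by apply: contrapT => /cU.2.
move=> b Ub; apply: contrapT => Tb.
suff /cU.2 : U (Neg b) by [].
apply: TU => /= Tnnb; apply: Tb; apply: mono Tnnb => v /=.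
by case: boolean_eval.
Qed.

Definition canonical_frame (L : set bform) : frame :=
  @Frame {T : set bform | complete_theory L T}
    (fun T U => forall a, sval U a -> sval T (Dia First a))
    (fun T U => forall a, sval U a -> sval T (Dia Second a)).

Definition canonical_val L (n : nat) (T : world (canonical_frame L)) : Prop :=
  sval T (Var n).

Lemma canonical_truth L T a : normal L ->
  sat (@canonical_val L) T a <-> sval T a.
Proof.
move=> nL; elim: a T => [n||b IHb c IHc|m b IHb] [T cT] //=.
- by split=> // /(complete_theory_Bot nL cT).
- by rewrite IHb IHc (complete_theory_ImpE _ _ nL cT).
- split=> [[U [TU /IHb Ub]]|Tb]; first by case: m TU; apply.
  have [U [cU Ub TU]] := complete_theory_Dia nL cT Tb.
  by exists (exist _ U cU); split; [case: m Tb TU | apply/IHb].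
Qed.

(** Abstracts the canonical model to three properties phrased by satisfaction: it characterises [L],
    it is tight, and distinct worlds are told apart by formulas. *)
Lemma canonical_model (L : set bform) : normal L ->
  exists F (V : nat -> world F -> Prop),
  [/\ forall a, L a <-> forall x, sat V x a,
      forall m x y, (forall a, sat V y a -> sat V x (Dia m a)) ->
        frame_rel m x y &
      forall x y, (forall a, sat V x a -> sat V y a) -> x = y].
Proof.
move=> nL; exists (canonical_frame L), (@canonical_val L).
have truth := canonical_truth; split.
- move=> a; split=> [La x|La]; first by apply/truth => //; apply: (svalP x).1.1.
  apply: contrapT => nLa.
  have thL : theory L L by split=> //; case: nL.
  have [U cU [_]] := lindenbaum nL thL nLa; apply.
  by apply/(truth _ (exist _ U cU)).
- move=> m x y xy.
  by case: m xy => xy a /(truth _ _ _ nL)/xy/(truth _ _ _ nL).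
- move=> [T cT] [U cU] TU.
  (* Between complete theories, inclusion already forces equality. *)
  have sTU : T `<=` U.
    by move=> a Ta; apply/(truth _ (exist _ U cU))/TU => //; apply/truth.
  suff TUE : T = U by case: _ / TUE in cU TU sTU *; congr exist; apply: Prop_irrelevance.
  apply/seteqP; split=> // a Ua; apply: contrapT => /cT.2/sTU/cU.2; exact.
Qed.

(** * Filtration *)

Definition generated_frame F (X : set (world F)) : frame :=
  @Frame {x | X x} (fun x y => rel1 (sval x) (sval y))
                   (fun x y => rel2 (sval x) (sval y)).

Lemma sat_generated F V (X : set (world F)) (x : world (generated_frame X)) a :
  (forall m y z, X y -> frame_rel m y z -> X z) ->
  sat (fun n (y : world (generated_frame X)) => V n (sval y)) x a <->
  sat V (sval x) a.
Proof.
move=> Xclosed; elim: a x => [n||b IHb c IHc|m b IHb] //= x.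
  by rewrite IHb IHc.
split=> [[y [xy /IHb yb]]|[y [xy yb]]].
  by exists (sval y); split=> //; case: m xy.
have Xy := Xclosed _ _ _ (svalP x) xy.
by exists (exist _ y Xy); split; [case: m xy | apply/IHb].
Qed.

Definition symmetric_rel1 (F : frame) : Prop :=
  forall x y : world F, rel1 x y -> rel1 y x.

Definition B_form : form unit := Imp (Var 0) (Box tt (Dia tt (Var 0))).

(** Tightness turns the axioms into frame conditions: [rel2] is symmetric and, up to equality, it is
    transitive and contains [rel1]. Hence the points equal or [rel2]-related to a refuting point are
    closed under both relations, and any two distinct ones are [rel2]-related. *)
Lemma neq_model (L : set bform) a :
  normal L -> neq_axioms `<=` L -> ~ L a ->
  exists F (V : nat -> world F -> Prop) (x0 : world F),
  [/\ forall b x, L b -> sat V x b, ~ sat V x0 a,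
      forall x y : world F, x <> y -> rel2 x y &
      L (bimodal B_form) -> symmetric_rel1 F].
Proof.
move=> nL neqL La; have [F [V [LE tight sep]]] := canonical_model nL.
have sL b c x : L b -> sat V x (subst (fun=> c) b).
  by move=> Lb; apply: (LE _).1; case: nL => _ _ _ + _; apply.
have nsep x y : x <> y -> exists2 b, sat V y b & ~ sat V x b.
  move=> xy; apply: contrapT => nb; apply: xy; apply/esym/sep => b yb.
  by apply: contrapT => xb; apply: nb; exists b.
have existsP (x y : world F) : (forall b, sat V y b -> sat V x (Exists b)) ->
    rel2 x y \/ x = y.
  move=> xy; have [->|/nsep[b yb xb]] := pselect (x = y); first by right.
  left; apply: (tight Second) => c yc.
  (* Since [b] fails at [x], conjoining it with [c] excludes [x] itself as the witness and leaves a
     proper [rel2]-successor. *)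
  have /sat_OrE[[z [xz /sat_AndE[zb zc]]]|/sat_AndE[/xb//]] :
      sat V x (Exists (And b c)) by apply/xy/sat_AndE.
  by exists z.
have rel1P (x y : world F) : rel1 x y -> rel2 x y \/ x = y.
  move=> xy; apply: existsP => b yb.
  have /(sL _ b x) : L (Imp (Dia First (Var 0)) (Exists (Var 0))).
    by apply: neqL; apply: Or33.
  by apply; exists y.
have sym2 (x y : world F) : rel2 x y -> rel2 y x.
  move=> xy; apply: (tight Second) => b xb.
  have LB : L (Imp (Var 0) (Box Second (Dia Second (Var 0)))).
    by apply: neqL; apply: Or31.
  exact: (sat_BoxE V x Second (Dia Second b)).1 (sL _ b x LB xb) y xy.
have trans2 (x y z : world F) : rel2 x y -> rel2 y z -> rel2 x z \/ x = z.
  move=> xy yz; apply: existsP => b zb.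
  have /(sL _ b x) : L (Imp (Dia Second (Dia Second (Var 0))) (Exists (Var 0))).
    by apply: neqL; apply: Or32.
  by apply; exists y; split=> //; exists z.
have [x0 x0a] : exists x, ~ sat V x a by apply/existsNP => xa; apply: La; apply: (LE a).2.
pose X x := rel2 x0 x \/ x0 = x.
have Xclosed m y z : X y -> frame_rel m y z -> X z.
  have X2 : X y -> rel2 y z -> X z.
    by move=> [x0y|<-] yz; [exact: trans2 yz | left].
  case: m => Xy; last exact: X2.
  by move=> /rel1P[|<-//]; apply: X2.
have Xx0 : X x0 by right.
exists (generated_frame X), (fun n x => V n (sval x)), (exist _ x0 Xx0); split.
- by move=> b x Lb; apply/sat_generated => //; apply: (LE b).1.
- by rewrite sat_generated.
- move=> [x Xx] [y Xy] nxy /=; have {}nxy : x <> y.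
    by move=> xy; apply: nxy; case: _ / xy Xy => Xy; congr exist; apply: Prop_irrelevance.
  case: Xx Xy nxy => [x0x|<-] [x0y|<-] // nxy.
  - by have [|/nxy] := trans2 _ _ _ (sym2 _ _ x0x) x0y.
  - exact: sym2.
- move=> LB [x Xx] [y Xy] /= xy; apply: (tight First) => b xb.
  exact: (sat_BoxE V x First (Dia First b)).1 (sL _ b x LB xb) y xy.
Qed.

(** An indexed family, possibly with repetitions, requires no decidable equality on formulas; its
    index type then carries the finite functions that serve as types. *)
Definition subformula_closed J (f : J -> bform) : Prop :=
  forall j, match f j with
            | Imp b c => (exists i, f i = b) /\ (exists i, f i = c)
            | Dia _ b => exists i, f i = b
            | _ => True
            end.

Lemma subformula_family a : exists (J : finType) (f : J -> bform),
  (exists j, f j = a) /\ subformula_closed f.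
Proof.
elim: a => [n||b [J [f [[j fj] fsub]]] c [K [g [[l gl] gsub]]]|m b [J [f [[j fj] fsub]]]].
- by exists unit, (fun=> Var n); split=> //; exists tt.
- by exists unit, (fun=> Bot); split=> //; exists tt.
- exists (option (J + K)%type), (fun o => match o with
    | Some (inl i) => f i | Some (inr i) => g i | None => Imp b c end).
  split; first by exists None.
  case=> [[i|i]|].
  + case: (f i) (fsub i) => // [b1 b2 [[i1 <-] [i2 <-]]|m' b1 [i1 <-]].
      by split; [exists (Some (inl i1)) | exists (Some (inl i2))].
    by exists (Some (inl i1)).
  + case: (g i) (gsub i) => // [b1 b2 [[i1 <-] [i2 <-]]|m' b1 [i1 <-]].
      by split; [exists (Some (inr i1)) | exists (Some (inr i2))].
    by exists (Some (inr i1)).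
  + by split; [exists (Some (inl j)) | exists (Some (inr l))].
- exists (option J), (fun o => if o is Some i then f i else Dia m b).
  split; first by exists None.
  case=> [i|]; last by exists (Some j).
  case: (f i) (fsub i) => // [b1 b2 [[i1 <-] [i2 <-]]|m' b1 [i1 <-]].
    by split; [exists (Some i1) | exists (Some i2)].
  by exists (Some i1).
Qed.

Definition world_type F V (J : finType) (f : J -> bform) (x : world F) :
  {ffun J -> bool} := [ffun j => `[< sat V x (f j) >]].

Definition describe (J : finType) (f : J -> bform) (t : {ffun J -> bool}) :=
  \big[@And modality/Top]_j (if t j then f j else Neg (f j)).

Lemma sat_describeE F V (J : finType) (f : J -> bform) t (x : world F) :
  sat V x (describe f t) <-> world_type V f x = t.
Proof.
rewrite sat_big_AndE; split=> [xt|<- j _].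
  apply/ffunP => j; rewrite ffunE; case: (t j) (xt j isT) => xj.
    exact/asboolP.
  exact/asboolF.
by rewrite ffunE; case: asboolP.
Qed.

Lemma world_type_sat F V (J : finType) (f : J -> bform) (x y : world F) j :
  world_type V f x = world_type V f y -> sat V x (f j) -> sat V y (f j).
Proof. by move=> /ffunP/(_ j); rewrite !ffunE => xyj /asboolP; rewrite xyj => /asboolP. Qed.

(* A type realised by two [rel2]-related worlds gets a second copy, so that
   inequality of vertices can simulate the reflexive point of the quotient. *)
Definition filtration_pred F V (J : finType) (f : J -> bform)
    (p : {ffun J -> bool} * bool) : bool :=
  `[< (exists x : world F, world_type V f x = p.1) /\
      (p.2 -> exists x y : world F, [/\ world_type V f x = p.1,
                                        world_type V f y = p.1 & rel2 x y]) >].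

Definition filtration_vertex F V (J : finType) (f : J -> bform) : Type :=
  {p | @filtration_pred F V J f p}.

(** The copy flag is ignored: both copies of a type have the same neighbours, so a type related to
    itself also yields loops. *)
Definition filtration_edge F V (J : finType) (f : J -> bform)
    (p q : @filtration_vertex F V J f) : Prop :=
  exists x y : world F, [/\ world_type V f x = (val p).1,
                            world_type V f y = (val q).1 & rel1 x y].

Lemma type_vertex_subproof F V (J : finType) (f : J -> bform) (x : world F) :
  filtration_pred V f (world_type V f x, false).
Proof. by apply/asboolP; split=> //; exists x. Qed.

Definition type_vertex F V (J : finType) (f : J -> bform) (x : world F) :
  filtration_vertex V f := exist (fun p => filtration_pred V f p) _ (type_vertex_subproof V f x).

Definition filtration F V (J : finType) (f : J -> bform) (x : world F) : digraph :=
  @Digraph (filtration_vertex V f) (@filtration_edge F V J f)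
    (inhabits (type_vertex V f x)).

(** For [First] this is the usual argument for the least filtration. For [Second], distinct vertices
    either have different types, realised by distinct and hence related worlds, or are the two
    copies of one type, which exist only if that type has two [rel2]-related worlds. *)
Lemma filtration_sat F V (J : finType) (f : J -> bform) (x0 : world F) a
    (G := filtration V f x0) :
  (forall x y : world F, x <> y -> rel2 x y) ->
  subformula_closed f ->
  (exists j, f j = a) ->
  forall (p : vertex G) (x : world F), world_type V f x = (val p).1 ->
    sat (F := neq_frame G)
      (fun n (q : vertex G) => exists2 y, world_type V f y = (val q).1 & V n y) p a
    <-> sat V x a.
Proof.
move=> neq2 fsub.
elim: a => [n||b IHb c IHc|m b IHb] //= [j fj]; have := fsub j; rewrite fj.
- move=> _ p x xp; split=> [[y yp yn]|xn]; last by exists x.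
  have := @world_type_sat _ V _ f y x j; rewrite fj; apply=> //.
  by rewrite xp.
- by move=> [/IHb{}IHb /IHc{}IHc] p x xp; rewrite (IHb p x) // (IHc p x).
move=> /IHb{}IHb p x xp; split.
- move=> [q [pq qb]].
  (* As [Dia m b] belongs to the family, it may be verified at any world of the type of [x]. *)
  have witness y z : world_type V f y = (val p).1 ->
      world_type V f z = (val q).1 -> frame_rel m y z -> sat V x (Dia m b).
    move=> yp zq yz; have := @world_type_sat _ V _ f y x j.
    rewrite fj; apply; first by rewrite yp xp.
    by exists z; split=> //; apply/(IHb q).
  case: m fj pq witness => {}fj pq witness.
    by have [y [z [yp zq yz]]] := pq; apply: witness yz.
  have /asboolP[[z zq] q2] := valP q.
  have [pq1|pq1] := eqVneq (val p).1 (val q).1; last first.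
    by apply: (witness x z) => //; apply: neq2 => xz; rewrite -xp -zq xz eqxx in pq1.
  (* The types agree but the vertices differ, so one of the two flags is set and supplies a related
     pair of that type. *)
  have [p2|p2] := boolP (val p).2.
    have /asboolP[_ /(_ p2)[y [y' [yp y'p yy']]]] := valP p.
    by apply: witness yp _ yy'; rewrite y'p.
  have [/q2[y [y' [yq y'q yy']]]|q2'] := boolP (val q).2.
    by apply: witness y'q yy'; rewrite yq.
  case: pq; apply: val_inj; move: pq1 p2 q2'.
  by case: (val p) (val q) => [p1 []] [q1 []] //= ->.
- move=> [y [xy yb]].
  have yq := (IHb (type_vertex V f y) y erefl).2 yb.
  case: m fj xy => fj xy; first by exists (type_vertex V f y); split=> //; exists x, y.
  have [yp|yp] := eqVneq (world_type V f y) (val p).1; last first.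
    by exists (type_vertex V f y); split=> //= pq; rewrite pq eqxx in yp.
  (* The successor must differ from [p] while having its type, so the other copy is taken; the pair
     [x], [y] shows that both copies exist. *)
  have Pq : filtration_pred V f ((val p).1, ~~ (val p).2).
    by apply/asboolP; split=> /= [|_]; [exists x | exists x, y].
  exists (exist (fun p => filtration_pred V f p) _ Pq); split; last by apply/(IHb _ y).
  by move=> pq; have := congr1 (fun r => (val r).2) pq => /=; case: (val p).2.
Qed.

(** Colour each world as the unflagged copy of its type. Colour classes are unions of finitely many
    types, hence definable, and the corresponding instance of [chi_form k] yields a monochromatic
    [rel1]-edge, which survives in the filtration. *)
Lemma filtration_monochromatic_edge F V (J : finType) (f : J -> bform) (x0 : world F) k
    (G := filtration V f x0) :
  (forall s, sat V x0 (subst s (chi_form k))) ->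
  forall c : vertex G -> 'I_k, exists x y : vertex G, edge x y /\ c x = c y.
Proof.
move=> chi c; pose col x := c (type_vertex V f x).
have col_type x y : world_type V f x = world_type V f y -> col x = col y.
  by move=> xy; congr c; apply: val_inj; rewrite /= xy.
(* The disjunction of the descriptions of all types coloured [n]; it is empty for [n >= k]. *)
pose s n := \big[@Or modality/Bot]_(t : {ffun J -> bool} |
  `[< exists2 x, world_type V f x = t & col x = n :> nat >]) describe f t.
have sE x (i : 'I_k) : sat V x (s i) <-> col x = i.
  rewrite /s sat_big_OrE; split=> [[t /asboolP[y <- yi] /sat_describeE xy]|xi].
    by rewrite (col_type _ _ xy); apply: val_inj.
  exists (world_type V f x); last exact/sat_describeE.
  by apply/asboolP; exists x => //; rewrite xi.
have /sat_subst/sat_chi_formE[|y _ [i [/sE yi [z yz /sE zi]]]] := chi s.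
  move=> y _; exists (col y); first exact/sE.
  by move=> j jy /sE yj; rewrite yj eqxx in jy.
exists (type_vertex V f y), (type_vertex V f z); split; first by exists y, z.
by rewrite -[LHS]/(col y) -[RHS]/(col z) yi zi.
Qed.

(** * Chromatic numbers and colourings *)

(** Fibres of a colouring without monochromatic edges form a proper partition into at most [k]
    blocks; conversely, numbering the blocks of a small proper partition gives such a colouring. For
    [k = 0] both sides hold, as vertices exist and no map into ['I_0] does. *)
Lemma chromatic_gtP G k : chromatic_gt G k <->
  forall c : vertex G -> 'I_k, exists x y : vertex G, edge x y /\ c x = c y.
Proof.
rewrite /chromatic_gt /chromatic_number; split=> [Gk c|noc].
  apply: contrapT => cP.
  (* Only colours in the range are used, because the blocks of a partition must be nonempty. *)
  pose A := [set c @^-1` [set i] | i in range c].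
  have Ak : A #<= `I_k.
    apply: card_le_trans (card_image_le _ _) _.
    have /card_eqPle[_ le] := inj_card_eq (f := val) (A := range c) (in2W val_inj).
    by apply: card_le_trans le _; apply: subset_card_le => _ [i _ <-] /=.
  have properA : proper_partition A.
    split; first split.
    - apply/seteqP; split=> // x _; exists (c @^-1` [set c x]) => //.
      by exists (c x) => //; exists x.
    - move=> _ _ [i _ <-] [j _ <-] [x [/= xi xj]].
      by rewrite -xi -xj.
    - by move=> _ [_ [x _ <-] <-]; exists x.
    - move=> _ [i _ <-] [x [y [/= xi yi xy]]].
      by apply: cP; exists x, y; split=> //; rewrite xi.
  have [n An] : finite_set A by exact: card_le_finite Ak (finite_II k).
  have nk : (n <= k)%N by rewrite -card_le_II -(card_le_eql An).
  have Gn : `[< partition_size G n >] by apply/asboolP; exists A.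
  move: Gk; case: pselect => [ex|[]]; last by exists n.
  by case: ex_minnP => m _ /(_ _ Gn) mn; rewrite ltnNge (leq_trans mn).
case: pselect => // ex; case: ex_minnP => n /asboolP[A [[[cov _ _] proper] An]] _.
rewrite ltnNge; apply/negP => nk.
have /card_set_bijP[h [hA hinj _]] := An.
have block x : exists2 B, A B & B x.
  by have : cover A id x; [rewrite cov | move=> [B AB Bx]; exists B].
(* The colour is the index of the block of [x] under a bijection of [A] with [I_n], and it is below
   [k] since [n <= k]. *)
pose c x : 'I_k := Ordinal (leq_trans (hA _ (s2valP (cid2 (block x)))) nk).
have [x [y [xy /(congr1 val)/= cxy]]] := noc c.
apply: (proper _ (s2valP (cid2 (block x)))); exists x, y; split=> //.
  exact: (s2valP' (cid2 (block x))).
rewrite (hinj _ _ _ _ cxy) ?inE; [|exact: s2valP..].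
exact: (s2valP' (cid2 (block y))).
Qed.

(** * Soundness and completeness *)

(** Symmetry is conditional on the translated axiom B, so that one construction serves graphs and
    directed graphs alike. *)
Lemma chi_completeness k (L : set bform) a :
  normal L -> neq_axioms `<=` L -> L (chi_form k) -> ~ L a ->
  exists G, [/\ chromatic_gt G k, L (bimodal B_form) -> symmetric_edge G &
                ~ valid (neq_frame G) a].
Proof.
move=> nL neqL chiL La.
have [F [V [x0 [VL x0a neq2 symF]]]] := neq_model nL neqL La.
have [J [f [fa fsub]]] := subformula_family a.
exists (filtration V f x0); split.
- apply/chromatic_gtP; apply: filtration_monochromatic_edge => s.
  by apply: VL; case: nL => _ _ _ + _; apply.
- move=> /symF symF' p q [x [y [xp yq xy]]].
  by exists y, x; split=> //; apply: symF'.
- move=> va; apply: x0a.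
  have satE := @filtration_sat F V J f x0 a neq2 fsub fa (type_vertex V f x0) x0.
  by apply: (satE erefl).1; apply: va.
Qed.

Lemma chi_form_valid G k : chromatic_gt G k -> valid (neq_frame G) (chi_form k).
Proof.
move=> /chromatic_gtP Gk V x; apply/sat_chi_formE => pick.
have allE y : (x : vertex G) <> y \/ x = y.
  by have [->|] := pselect ((x : vertex G) = y); [right|left].
pose c y : 'I_k := s2val (cid2 (pick y (allE y))).
have cV y : V (c y) y by exact: s2valP (cid2 (pick y (allE y))).
have [y [z [yz cyz]]] := Gk c.
exists y; first exact: allE.
by exists (c y); split=> //; exists z => //; rewrite cyz.
Qed.

Lemma extend_neq_logic_sub (L0 : set (form unit)) k :
  let L := extend (neq_logic L0) [set chi_form k] in
  [/\ normal L, bimodal @` L0 `<=` L, neq_axioms `<=` L & L (chi_form k)].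
Proof.
have sub : neq_logic L0 `<=` extend (neq_logic L0) [set chi_form k].
  by apply: sub_smallest => a; left.
split.
- exact: smallest_normal.
- by move=> a L0a; apply: sub; apply: sub_gen_smallest; left.
- by move=> a aneq; apply: sub; apply: sub_gen_smallest; right.
- by apply: sub_gen_smallest; right.
Qed.

Lemma logicKB_B_form : logicKB B_form.
Proof. by apply: sub_gen_smallest; right. Qed.

Theorem theorem2 (k : nat) :
  logic_of (neq_class (graphs_gt k))
    = extend (neq_logic logicKB) [set chi_form k] /\
  logic_of (neq_class (digraphs_gt k))
    = extend (neq_logic logicK) [set chi_form k].
Proof.
have neqV C : neq_axioms `<=` logic_of (neq_class C).
  by move=> a aneq F [G _ ->]; apply: neq_axioms_valid.
have KV C : logicK `<=` bimodal @^-1` logic_of (neq_class C).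
  by apply: smallest_sub => //; apply/normal_bimodal/normal_logic_of.
split; apply/seteqP; split.
- have [nL L0L neqL chiL] := extend_neq_logic_sub logicKB k.
  move=> a aV; apply: contrapT => /(chi_completeness nL neqL chiL)[G [Gk symG]].
  apply; apply: aV; exists G => //; split=> //.
  by apply: symG; apply: L0L; exists B_form => //; apply: logicKB_B_form.
- apply: chi_logic_sub => //; first exact: normal_logic_of.
  + apply: smallest_sub; first exact/normal_bimodal/normal_logic_of.
    move=> a [/KV //|-> F [G [symG _] ->] V x xp].
    apply: (sat_BoxE V x First (Dia First (Var 0))).2 => y xy.
    by exists x; split=> //; apply: symG.
  + by move=> F [G [_ Gk] ->]; apply: chi_form_valid.
- have [nL L0L neqL chiL] := extend_neq_logic_sub logicK k.
  move=> a aV; apply: contrapT => /(chi_completeness nL neqL chiL)[G [Gk _]].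
  by apply; apply: aV; exists G.
- apply: chi_logic_sub => //; first exact: normal_logic_of.
  by move=> F [G Gk ->]; apply: chi_form_valid.
Qed.
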